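(* Let $\Omega\subseteq\mathbb{R}^2$ be an unbounded open convex set, with $r_\Omega<+\infty$. If $0<q<1$, then we have \[ h_q(\Omega)=0. \]
   Context: For an open set $\Omega\subseteq\mathbb{R}^2$ and $0<q<2$, the generalized Cheeger constant is \[ h_q(\Omega)=\inf\left\{\frac{\mathcal{H}^{1}(\partial E)}{|E|^{1/q}}\, :\, E\Subset\Omega \text{ non-empty open set with smooth boundary}\right\}, \] where $|\cdot|$ is the two-dimensional Lebesgue measure, $\mathcal{H}^{1}$ is the one-dimensional Hausdorff measure, and $E\Subset\Omega$ means that $\overline{E}$ is a compact subset of $\Omega$. The inradius $r_\Omega$ of $\Omega$ is the supremum of the radii of the open disks entirely contained in $\Omega$. *)

(* Defs.v *)
From HB Require Import structures.
From mathcomp Require Export all_boot all_order all_algebra.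
From mathcomp Require Export all_classical all_reals all_analysis.

Set Implicit Arguments.
Unset Strict Implicit.
Unset Printing Implicit Defensive.

Export Order.TTheory GRing.Theory Num.Theory.
Export numFieldNormedType.Exports.

Local Open Scope classical_set_scope.
Local Open Scope ring_scope.

(* The plane is [R * R].  Its library norm is the max norm, which gives the
   usual topology and bounded sets; all metric notions below (disks, diameters,
   inradius, Hausdorff measure) use the Euclidean distance instead. *)

Definition dot2 (R : realType) (x y : R * R) : R := x.1 * y.1 + x.2 * y.2.

Definition dist2 (R : realType) (x y : R * R) : R :=
  Num.sqrt (dot2 (x - y) (x - y)).

Definition disk (R : realType) (p : R * R) (r : R) : set (R * R) :=
  [set x | dist2 x p < r].

Definition boundary (T : topologicalType) (A : set T) : set T :=
  closure A `\` interior A.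

(* The maximum with 0 makes the diameter of the empty set 0 instead of -oo. *)
Definition diam2 (R : realType) (A : set (R * R)) : \bar R :=
  maxe 0%E (ereal_sup [set z | exists x y, [/\ A x, A y & z = (dist2 x y)%:E]]).

(* In dimension one the normalizing factor of the Hausdorff measure is 1. *)
Definition hausdorff1_pre (R : realType) (delta : R) (A : set (R * R)) : \bar R :=
  ereal_inf [set z | exists U : nat -> set (R * R),
    [/\ A `<=` \bigcup_i U i,
        (forall i, (diam2 (U i) <= delta%:E)%E) &
        z = (\sum_(0 <= i <oo) diam2 (U i))%E]].

Definition hausdorff1 (R : realType) (A : set (R * R)) : \bar R :=
  ereal_sup [set hausdorff1_pre delta A | delta in [set d : R | 0 < d]].

Definition area (R : realType) (A : set (R * R)) : \bar R :=
  (@lebesgue_measure R \x @lebesgue_measure R)%E A.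

Definition smooth_on (R : realType) (r : R) (g : R -> R) : Prop :=
  forall (n : nat) (t : R), - r < t < r -> derivable (g^`(n))%classic t 1.

(* Near each boundary point p, in the orthonormal frame centered at p with axes
   (- nu.2, nu.1) and nu, the set E is the strict subgraph of a C^oo function.
   Only the values of g on ]-r, r[ matter. *)
Definition smooth_boundary (R : realType) (E : set (R * R)) : Prop :=
  forall p, boundary E p ->
    exists (nu : R * R) (r : R) (g : R -> R),
      [/\ dot2 nu nu = 1, 0 < r, smooth_on r g &
          forall x, disk p r x ->
            (E x <-> dot2 (x - p) nu < g (dot2 (x - p) (- nu.2, nu.1)))].

Definition compactly_contained (R : realType) (E Omega : set (R * R)) : Prop :=
  compact (closure E) /\ closure E `<=` Omega.

Definition cheeger (R : realType) (q : R) (Omega : set (R * R)) : \bar R :=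
  ereal_inf [set z | exists E : set (R * R),
    [/\ E !=set0, open E, smooth_boundary E, compactly_contained E Omega &
        z = (hausdorff1 (boundary E) / (area E `^ q^-1))%E]].

Definition inradius (R : realType) (Omega : set (R * R)) : \bar R :=
  ereal_sup [set rho%:E |
    rho in [set r : R | 0 < r /\ exists p, disk p r `<=` Omega]].

(* Main.v *)
(** A disk of radius rho inside Omega and a far away point of Omega span, by
    convexity, a long region containing n disks of radius r = rho / 4 whose
    centers are pairwise at distance at least 4 r.  Their union E has perimeter
    at most 8 r n and area at least n r^2 (inscribed squares), so that its
    Cheeger quotient is O(n^(1 - 1/q)), which tends to 0 because q < 1.
    A smooth connected competitor is not needed, since E is only required to be
    an open set with smooth boundary. *)

Require Import Defs.
From mathcomp Require Import ring lra zify measurable_realfun.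
Set Implicit Arguments.
Unset Strict Implicit.
Unset Printing Implicit Defensive.

Local Open Scope classical_set_scope.
Local Open Scope ring_scope.

(** * Smoothness of a circular arc as a graph *)

Section circular_arc.
Context {R : realType}.
Implicit Types (r t : R) (P : {poly R}).

Let w r t := Num.sqrt (r ^+ 2 - t ^+ 2).

Lemma sqr_lt_of_itv r t : - r < t < r -> 0 < r ^+ 2 - t ^+ 2.
Proof. move=> /andP[? ?]; nra. Qed.

Lemma is_derive_sqrt_arc r t : - r < t < r ->
  is_derive t 1 (w r) (- t * (w r t)^-1).
Proof.
move=> tr; have w0 := sqr_lt_of_itv tr.
have -> : w r = Num.sqrt \o (fun s => r ^+ 2 - s ^+ 2) by [].
have d1 : is_derive t 1 (fun s : R => r ^+ 2 - s ^+ 2) (- (2 * t)).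
  apply: is_derive_eq; rewrite /GRing.scale /=; ring.
have d2 := is_derive1_sqrt w0.
have s0 : Num.sqrt (r ^+ 2 - t ^+ 2) != 0 by rewrite gt_eqF // sqrtr_gt0.
refine (is_derive_eq (is_derive1_comp (f := Num.sqrt) (g := fun s => r ^+ 2 - s ^+ 2) d2 d1) _).
rewrite /w /GRing.scale /=; field; exact: s0.
Qed.

(** Since [w' = - t / w], the derivative is [P' w^-m + m t P w^-(m+2)]; writing [w^-m] as
    [(r^2 - t^2) w^-(m+2)] brings both terms to the same power of [w]. *)
Lemma is_derive_poly_arc r t P m : - r < t < r ->
  is_derive t 1 (fun s => P.[s] * ((w r s)^-1) ^+ m)
    ((P^`() * (r ^+ 2 *: 1 - 'X ^+ 2) + m%:R *: ('X * P)).[t]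
      * ((w r t)^-1) ^+ (m + 2)).
Proof.
move=> tr; have w0 := sqr_lt_of_itv tr.
have s0 : w r t != 0 by rewrite gt_eqF // sqrtr_gt0.
have dw := is_derive_sqrt_arc tr.
have dv : is_derive t 1 (fun s => (w r s)^-1) (t * (w r t)^-1 ^+ 3).
  refine (is_derive_eq (is_deriveV s0 dw) _).
  rewrite /GRing.scale /=; field; exact: s0.
have dp : is_derive t 1 (fun s => P.[s]) (P^`().[t]) by exact: is_derive_poly.
have dm : is_derive t 1 (fun s => ((w r s)^-1) ^+ m) (m%:R * (t * (w r t)^-1 ^+ (m + 2))).
  case: m => [|m].
    rewrite mul0r; under eq_fun do rewrite expr0; exact: is_derive_cst.
  rewrite -[fun s => _](exprfctE (fun s => (w r s)^-1) m.+1).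
  refine (is_derive_eq (is_deriveX m.+1 dv) _).
  by rewrite /GRing.scale /= -mulr_natl addSnnS exprD; ring.
refine (is_derive_eq (is_deriveM dp dm) _).
have e : (r ^+ 2 - t ^+ 2) * (w r t)^-1 ^+ 2 = 1.
  by rewrite exprVn sqr_sqrtr ?divff ?gt_eqF // ltW.
rewrite !hornerE /GRing.scale /= exprD -[X in _ + X = _]mulr1 -e.
ring.
Qed.

(* The class of functions P(t) w(t)^-m, with P a polynomial, is stable under
   differentiation. *)
Lemma derive1n_arc r n : exists P m, forall t, - r < t < r ->
  ((fun s => w r s - r)^`(n.+1))%classic t = P.[t] * ((w r t)^-1) ^+ m.
Proof.
elim: n => [|n [P [m IH]]].
  (* Orders start at one, where differentiation has removed the constant [- r]. *)
  exists (- 'X), 1%N => t tr; rewrite derive1n1 derive1E.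
  have dw := is_derive_sqrt_arc tr.
  by rewrite deriveB // derive_val derive_cst subr0 !hornerE.
exists (P^`() * (r ^+ 2 *: 1 - 'X ^+ 2) + m%:R *: ('X * P)), (m + 2)%N => t tr.
rewrite derive1nS derive1E.
(* The induction hypothesis holds on the open interval, a neighborhood of [t], which is enough to
   differentiate it at [t]. *)
have dw := is_derive_poly_arc P m tr.
rewrite -(@derive_val _ _ _ _ _ _ _ dw); apply: near_eq_derive.
have: t \in `]- r, r[ by rewrite in_itv /=.
by move/near_in_itvoo; apply: filterS => s; rewrite in_itv /= => /IH.
Qed.

(** This is the boundary chart of a disk of radius [r], in the frame centered at a boundary point
    with the outer normal as second axis. *)
Lemma smooth_arc r : smooth_on r (fun t => w r t - r).
Proof.
move=> [|n] t tr.
  have dw := is_derive_sqrt_arc tr.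
  by rewrite derive1n0; apply: derivableB.
have [P [m e]] := derive1n_arc r n.
have dw := is_derive_poly_arc P m tr.
apply: (near_eq_derivable (f := fun s => P.[s] * ((w r s)^-1) ^+ m)); last by [].
have: t \in `]- r, r[ by rewrite in_itv /=.
by move/near_in_itvoo; apply: filterS => s; rewrite in_itv /= => /e /esym.
Qed.
End circular_arc.

(** * Euclidean distance, topology and area of disks *)

Section dist.
Context {R : realType}.
Implicit Types (x y z p : R * R) (r : R).

Lemma dist2E x y : dist2 x y = Num.sqrt ((x.1 - y.1) ^+ 2 + (x.2 - y.2) ^+ 2).
Proof. by []. Qed.

Lemma dist2_ge0 x y : 0 <= dist2 x y.
Proof. exact: sqrtr_ge0. Qed.

Lemma sqr_dist2 x y : dist2 x y ^+ 2 = (x.1 - y.1) ^+ 2 + (x.2 - y.2) ^+ 2.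
Proof. by rewrite dist2E sqr_sqrtr // addr_ge0 // sqr_ge0. Qed.

Lemma dist2C x y : dist2 x y = dist2 y x.
Proof. by rewrite !dist2E -(sqrrN (x.1 - y.1)) -(sqrrN (x.2 - y.2)) !opprB. Qed.

Lemma dist2_lt x y r : 0 < r ->
  (dist2 x y < r) = ((x.1 - y.1) ^+ 2 + (x.2 - y.2) ^+ 2 < r ^+ 2).
Proof. by move=> r0; rewrite -sqr_dist2 ltr_pXn2r // nnegrE ?dist2_ge0 // ltW. Qed.

Lemma dist2_le x y r : 0 <= r ->
  (dist2 x y <= r) = ((x.1 - y.1) ^+ 2 + (x.2 - y.2) ^+ 2 <= r ^+ 2).
Proof. by move=> r0; rewrite -sqr_dist2 ler_pXn2r // nnegrE ?dist2_ge0. Qed.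

Lemma dist2_triangle y x z : dist2 x z <= dist2 x y + dist2 y z.
Proof.
have a0 := dist2_ge0 x y; have b0 := dist2_ge0 y z.
have a2 := sqr_dist2 x y; have b2 := sqr_dist2 y z.
rewrite dist2_le ?addr_ge0 //.
set a := dist2 x y in a0 a2 *; set b := dist2 y z in b0 b2 *.
have -> : x.1 - z.1 = (x.1 - y.1) + (y.1 - z.1) by ring.
have -> : x.2 - z.2 = (x.2 - y.2) + (y.2 - z.2) by ring.
move: a2 b2; set s := x.1 - y.1; set t := x.2 - y.2.
set u := y.1 - z.1; set v := y.2 - z.2 => a2 b2.
(* Cauchy-Schwarz, where Lagrange's identity exhibits the difference of the squares as a square. *)
have : s * u + t * v <= a * b.
  have [h|h] := lerP (s * u + t * v) 0; first by rewrite (le_trans h) // mulr_ge0.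
  rewrite -(@ler_pXn2r _ 2) // ?nnegrE ?mulr_ge0 ?(ltW h) //.
  rewrite exprMn a2 b2 -subr_ge0.
  have -> : (s ^+ 2 + t ^+ 2) * (u ^+ 2 + v ^+ 2) - (s * u + t * v) ^+ 2
    = (s * v - t * u) ^+ 2 by ring.
  exact: sqr_ge0.
move=> h; rewrite -subr_ge0.
have -> : (a + b) ^+ 2 = a ^+ 2 + b ^+ 2 + 2 * (a * b) by ring.
rewrite a2 b2 [X in 0 <= X](_ : _ = 2 * (a * b - (s * u + t * v))); last by ring.
by rewrite mulr_ge0 // subr_ge0.
Qed.

Lemma continuous_dist2 p : continuous (fun x => dist2 x p).
Proof.
have c1 : continuous (fun x : R * R => x.1 - p.1).
  by move=> x; apply: cvgB; [exact: cvg_fst | exact: cvg_cst].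
have c2 : continuous (fun x : R * R => x.2 - p.2).
  by move=> x; apply: cvgB; [exact: cvg_snd | exact: cvg_cst].
move=> x; apply: (@continuous_comp _ _ _ (fun x => dot2 (x - p) (x - p)) Num.sqrt).
  by apply: cvgD; apply: cvgM; [exact: c1| exact: c1| exact: c2| exact: c2].
exact: sqrt_continuous.
Qed.

Lemma open_disk p r : open (disk p r).
Proof.
apply: (@open_comp _ _ (fun x => dist2 x p) [set t | t < r]).
  by move=> x _; exact: continuous_dist2.
exact: open_lt.
Qed.

Lemma closed_cdisk p r : closed [set x | dist2 x p <= r].
Proof.
apply: (@preimage_closed _ _ (fun x => dist2 x p) [set t | t <= r]).
  by move=> x _; exact: continuous_dist2.
exact: closed_le.
Qed.

Lemma abs_fst_le_dist2 x y : `|x.1 - y.1| <= dist2 x y.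
Proof.
rewrite -[leLHS]sqrtr_sqr ler_sqrt ?lerDl ?sqr_ge0 //.
by rewrite addr_ge0 // -expr2 sqr_ge0.
Qed.

Lemma abs_snd_le_dist2 x y : `|x.2 - y.2| <= dist2 x y.
Proof.
rewrite -[leLHS]sqrtr_sqr ler_sqrt ?lerDr ?sqr_ge0 //.
by rewrite addr_ge0 // -expr2 sqr_ge0.
Qed.

Lemma norm_le_dist2 x y : `|x - y| <= dist2 x y.
Proof. by rewrite prod_normE ge_max abs_fst_le_dist2 abs_snd_le_dist2. Qed.

Lemma compact_cdisk p r : compact [set x | dist2 x p <= r].
Proof.
have k := compact_setX (@segment_compact _ (p.1 - r) (p.1 + r))
  (@segment_compact _ (p.2 - r) (p.2 + r)).
refine (subclosed_compact (@closed_cdisk p r) k _).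
move=> x /= xr; split => /=; rewrite in_itv /=.
  by rewrite -ler_distl (le_trans (abs_fst_le_dist2 _ _)).
by rewrite -ler_distl (le_trans (abs_snd_le_dist2 _ _)).
Qed.

Lemma measurable_disk p r : measurable (disk p r).
Proof.
have [r0|r0] := ltP 0 r; last first.
  have -> : disk p r = set0; last exact: measurable0.
  apply/seteqP; split => x //= xr.
  by have := dist2_ge0 x p; rewrite leNgt (lt_le_trans xr r0).
have m : measurable_fun [set: R * R]
    (fun x : R * R => (x.1 - p.1) ^+ 2 + (x.2 - p.2) ^+ 2).
  apply: measurable_funD; apply: measurable_funX; apply: measurable_funB => //.
have := m measurableT _ (measurable_itv `]-oo, (r ^+ 2)[).
rewrite setTI; congr measurable; apply/seteqP.
by split => x; rewrite /disk /= in_itv /= dist2_lt.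
Qed.


(** Packaging the product as a measure gives [area] monotonicity and additivity. *)
Definition area_measure :=
  [the measure _ _ of (@lebesgue_measure R \x @lebesgue_measure R)%E].

Lemma areaE (A : set (R * R)) : area A = area_measure A.
Proof. by []. Qed.

(** The open square [Q] of side [r] centered at [p] has half-diagonal [r / sqrt 2 < r]. *)
Lemma area_disk_ge p r : 0 < r -> ((r ^+ 2)%:E <= area (disk p r))%E.
Proof.
move=> r0.
pose Q := `](p.1 - r / 2), (p.1 + r / 2)[%classic `*`
  `](p.2 - r / 2), (p.2 + r / 2)[%classic : set (R * R).
have -> : ((r ^+ 2)%:E = area Q)%E.
  rewrite /area product_measure1E //= !lebesgue_measure_itv /= !lte_fin.
  have -> : forall u : R, u - r / 2 < u + r / 2 by move=> u; lra.
  have -> : forall u : R, u - r / 2 < u + r / 2 by move=> u; lra.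
  rewrite -!EFinB -EFinM; congr _%:E; by field.
rewrite !areaE; apply: le_measure; rewrite ?inE; first exact: measurableX.
  exact: measurable_disk.
move=> x [] /=; rewrite !in_itv /= => /andP[? ?] /andP[? ?].
rewrite /disk /= dist2_lt //; nra.
Qed.
End dist.

(** * Upper bounds for the Hausdorff measure of Lipschitz curves and circles *)

Section hausdorff.
Context {R : realType}.

Lemma diam2_ge0 (A : set (R * R)) : (0 <= diam2 A)%E.
Proof. by rewrite le_max lexx. Qed.

Lemma diam2_le (A : set (R * R)) (d : R) : 0 <= d ->
  (forall x y, A x -> A y -> dist2 x y <= d) -> (diam2 A <= d%:E)%E.
Proof.
move=> d0 Ad; rewrite ge_max lee_fin d0 /=.
by apply: ge_ereal_sup => _ [x [y [Ax Ay ->]]]; rewrite lee_fin Ad.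
Qed.

Lemma hausdorff1_ge0 (A : set (R * R)) : (0 <= hausdorff1 A)%E.
Proof.
apply: (@le_trans _ _ (hausdorff1_pre 1 A)).
  apply: le_ereal_inf_tmp => _ [U [_ _ ->]].
  by apply: nneseries_ge0 => i _ _; exact: diam2_ge0.
by apply: ereal_sup_ubound; exists 1 => //=.
Qed.

(** Cutting each of the [J] curves into [M] pieces of equal parameter length gives diameters at most
    [L / M]. This is below any prescribed mesh for large [M], while the sum over the [J * M] pieces
    stays at most [J * L]. *)
Lemma hausdorff1_lipschitz_le (A : set (R * R)) (J : nat) (L : R)
    (f : nat -> R -> R * R) : 0 <= L ->
  (forall j s t, dist2 (f j s) (f j t) <= L * `|s - t|) ->
  A `<=` \bigcup_(j in `I_J) (f j @` [set t | 0 <= t < 1]) ->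
  (hausdorff1 A <= (J%:R * L)%:E)%E.
Proof.
move=> L0 fL Af; apply: ge_ereal_sup => _ [d /= d0 <-].
pose M := (Num.truncn (L / d)).+1.
have M0 : 0 < M%:R :> R by rewrite ltr0n.
have LM : L / M%:R <= d.
  rewrite ler_pdivrMr // mulrC -ler_pdivrMr //; apply: ltW; exact: truncnS_gt.
(* The index [i] encodes piece [i %% M] of curve [i %/ M]; the rest of the sequence is padded with
   empty sets, of diameter 0. *)
pose U i := if (i < J * M)%N then
  f (i %/ M)%N @` [set t | (i %% M)%N%:R <= t * M%:R < (i %% M)%N%:R + 1] else set0.
have LM0 : 0 <= L / M%:R by rewrite divr_ge0 // ltW.
have dU i : (diam2 (U i) <= (if (i < J * M)%N then L / M%:R else 0)%:E)%E.
  rewrite /U; case: ifPn => _; last by apply: diam2_le.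
  apply: diam2_le => // _ _ [s /= /andP[s1 s2] <-] [t /= /andP[t1 t2] <-].
  apply: (le_trans (fL _ _ _)); apply: ler_wpM2l => //.
  have -> : s - t = (s * M%:R - t * M%:R) / M%:R by field; rewrite gt_eqF.
  rewrite normrM (ger0_norm (x := M%:R^-1)) ?invr_ge0 ?(ltW M0) //.
  rewrite ler_pdivrMr // mulVf ?gt_eqF // ler_norml; lra.
apply: (@le_trans _ _ (\sum_(0 <= i <oo) diam2 (U i))%E).
  apply: ereal_inf_lbound; exists U; split => //.
    move=> x /Af [j /= jJ [t /andP[t0 t1] <-]].
    have [k /andP[k1 k2] kM] : exists2 k, k%:R <= t * M%:R < k.+1%:R & (k < M)%N.
      exists (Num.truncn (t * M%:R)); first by rewrite truncn_itv // mulr_ge0 // ltW.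
      by rewrite truncn_lt_nat ?mulr_ge0 ?(ltW M0) // gtr_pMl.
    exists (j * M + k)%N => //; rewrite /U.
    rewrite divnMDl // divn_small // addn0 modnMDl modn_small // ifT; last first.
      by rewrite -ltn_divLR // divnMDl // divn_small // addn0.
    by exists t => //=; rewrite k1 natr1.
  move=> i; apply: (le_trans (dU i)); rewrite lee_fin.
  by case: ifP => // _; exact: ltW.
apply: (le_trans (lee_nneseries
  (v := fun i => (if (i < J * M)%N then L / M%:R else 0)%:E) _ _)) => //.
  by move=> i *; exact: diam2_ge0.
rewrite (nneseries_split 0 (J * M)%N); last by move=> k _; rewrite lee_fin; case: ifP.
rewrite add0n [X in (_ + X)%E]eseries0; last first.
  by move=> i Ji _; rewrite ltnNge Ji.
rewrite addr0 big_mkord (eq_bigr (fun=> (L / M%:R)%:E)); last first.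
  by move=> i _; rewrite ltn_ord.
rewrite sumEFin sumr_const card_ord lee_fin -[leLHS]mulr_natl natrM -mulrA.
by rewrite (mulrC M%:R) divfK // gt_eqF.
Qed.

(* The rational parametrization of the half circle, by stereographic projection. *)
Definition half_circle (c : R * R) (r : R) (b : bool) (s : R) : R * R :=
  let t := 2 * s - 1 in
  (c.1 + (-1) ^+ b * r * (1 - t ^+ 2) / (1 + t ^+ 2),
   c.2 + (-1) ^+ b * r * (2 * t) / (1 + t ^+ 2)).

(** For stereographic parameters [u] and [v], the squared chord is
    [4 r^2 (u - v)^2 / ((1 + u^2) (1 + v^2))], and [u - v = 2 (s - t)]. *)
Lemma half_circle_lipschitz c r b s t : 0 <= r ->
  dist2 (half_circle c r b s) (half_circle c r b t) <= 4 * r * `|s - t|.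
Proof.
move=> r0; rewrite dist2_le ?mulr_ge0 //= !exprMn real_normK ?num_real //.
set u := 2 * s - 1; set v := 2 * t - 1.
have u0 : 0 < 1 + u ^+ 2 by rewrite ltr_pwDl // sqr_ge0.
have v0 : 0 < 1 + v ^+ 2 by rewrite ltr_pwDl // sqr_ge0.
have -> : 4 ^+ 2 * r ^+ 2 * (s - t) ^+ 2 = 4 * r ^+ 2 * (u - v) ^+ 2.
  by rewrite /u /v; ring.
set e := (-1) ^+ b.
have e2 : e ^+ 2 = 1 by rewrite /e sqrr_sign.
rewrite [leLHS](_ : _ = 4 * (e ^+ 2 * r ^+ 2) * (u - v) ^+ 2
    / ((1 + u ^+ 2) * (1 + v ^+ 2))); last by field; rewrite !gt_eqF.
have p0 : 0 <= 4 * r ^+ 2 * (u - v) ^+ 2.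
  by apply: mulr_ge0; [apply: mulr_ge0 => //|]; exact: sqr_ge0.
rewrite e2 mul1r ler_piMr //.
rewrite invf_le1 ?mulr_gt0 // -[leLHS]mulr1 ler_pM //.
  by rewrite lerDl sqr_ge0.
by rewrite lerDl sqr_ge0.
Qed.

(* (u, v) on the unit circle has parameter v / (1 + u), in [-1, 1[ iff 0 <= u
   and v < 1 + u; all other points of the circle are antipodal to such points. *)
Lemma circle_half_circle c r x : 0 < r -> dist2 x c = r ->
  exists b, (half_circle c r b @` [set t | 0 <= t < 1]) x.
Proof.
move=> r0 xr.
have h : forall (b : bool) u v, u ^+ 2 + v ^+ 2 = 1 ->
    x.1 = c.1 + (-1) ^+ b * r * u -> x.2 = c.2 + (-1) ^+ b * r * v ->
    0 <= u -> v < 1 + u ->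
    (half_circle c r b @` [set t | 0 <= t < 1]) x.
  move=> b u v uv x1 x2 u0 vu.
  have u1 : 0 < 1 + u by lra.
  have v1 : -1 <= v by nra.
  exists ((1 + v / (1 + u)) / 2) => /=.
    have vl : v / (1 + u) < 1 by rewrite ltr_pdivrMr // mul1r.
    have vg : -1 <= v / (1 + u) by rewrite ler_pdivlMr //; lra.
    lra.
  rewrite /half_circle (_ : 2 * _ - 1 = v / (1 + u)); last by field; rewrite gt_eqF.
  (* With this value of the squared parameter, the two coordinates of the parametrization reduce to
     [u] and [v]. *)
  have t2 : (v / (1 + u)) ^+ 2 = (1 - u) / (1 + u).
    have -> : (v / (1 + u)) ^+ 2 = v ^+ 2 / (1 + u) ^+ 2 by rewrite expr_div_n.
    have -> : v ^+ 2 = (1 - u) * (1 + u) by rewrite -(addKr (u ^+ 2) (v ^+ 2)) uv; ring.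
    by field; rewrite gt_eqF.
  rewrite [RHS]surjective_pairing x1 x2 t2; congr (_, _).
    by field; rewrite gt_eqF //=; lra.
  by field; rewrite gt_eqF //=; lra.
have uv : ((x.1 - c.1) / r) ^+ 2 + ((x.2 - c.2) / r) ^+ 2 = 1.
  by rewrite !exprMn -mulrDl -sqr_dist2 xr exprVn divff // expf_neq0 // gt_eqF.
move: uv; set u := _ / r; set v := _ / r => uv.
have x1 : x.1 = c.1 + r * u by rewrite /u; field; rewrite gt_eqF.
have x2 : x.2 = c.2 + r * v by rewrite /v; field; rewrite gt_eqF.
have [/andP[u0 vu]|] := boolP ((0 <= u) && (v < 1 + u)).
  by exists false; apply: (h _ u v) => //; rewrite expr0 mul1r.
rewrite negb_and -ltNge -leNgt => /orP n.
(* If [u < 0] or [1 + u <= v], then [u <= 0] because [v <= 1], and the antipode [(- u, - v)] meets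
   both conditions of [h]. *)
exists true; apply: (h _ (- u) (- v)); rewrite ?expr1 ?sqrrN //.
- by rewrite x1; ring.
- by rewrite x2; ring.
- case: n => n; first lra.
  nra.
- case: n => n; nra.
Qed.
End hausdorff.

(** * Finite unions of well separated disks *)

Section union_of_disks.
Context {R : realType}.
Variables (c : nat -> R * R) (n : nat) (r : R).
Hypothesis r0 : 0 < r.
(** The distance [4 r] makes the disks disjoint and also ensures that a disk of radius [r] about a
    boundary point meets only one of them. *)
Hypothesis sep : forall i j, (i < n)%N -> (j < n)%N -> i != j ->
  4 * r <= dist2 (c i) (c j).

Let E := \bigcup_(i in `I_n) disk (c i) r.

Lemma open_disks : open E.
Proof. by apply: bigcup_open => i _; exact: open_disk. Qed.

Lemma closure_disks : closure E `<=` \bigcup_(i in `I_n) [set x | dist2 x (c i) <= r].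
Proof.
have /closure_id -> : closed (\bigcup_(i in `I_n) [set x | dist2 x (c i) <= r]).
  by apply: closed_bigcup => // i _; exact: closed_cdisk.
by apply: closure_subset => x [i ni xi]; exists i => //; exact: ltW.
Qed.

Lemma compact_closure_disks : compact (closure E).
Proof.
apply: (@subclosed_compact _ _ (\bigcup_(i in `I_n) [set x | dist2 x (c i) <= r])).
- exact: closed_closure.
- by rewrite bigcup_mkord; apply: bigsetU_compact => i _; exact: compact_cdisk.
- exact: closure_disks.
Qed.

Lemma boundary_disks p : boundary E p -> exists2 i, (i < n)%N & dist2 p (c i) = r.
Proof.
move=> [/closure_disks[i /= ni]]; rewrite le_eqVlt => /predU1P[|pi]; first by exists i.
by move=> []; apply: open_disks; exists i.
Qed.

Lemma hausdorff1_boundary_disks : (hausdorff1 (boundary E) <= (n%:R * (8 * r))%:E)%E.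
Proof.
have -> : n%:R * (8 * r) = (n.*2)%:R * (4 * r) by rewrite -mul2n natrM; ring.
(* There are [2 n] half circles: [j./2] selects the disk and the parity of [j] the half. *)
apply: (@hausdorff1_lipschitz_le _ _ _ _ (fun j => half_circle (c j./2) r (odd j))).
- by rewrite mulr_ge0 // ltW.
- by move=> j s t; apply: half_circle_lipschitz; exact: ltW.
move=> p /boundary_disks[i ni /(circle_half_circle r0)[b pb]].
exists (b + i.*2)%N => /=; first by case: b {pb} => /=; lia.
by rewrite half_bit_double oddD odd_double addbF; case: b pb.
Qed.

Lemma disks_trivIset i j (x : R * R) : (i < n)%N -> (j < n)%N ->
  disk (c i) r x -> disk (c j) r x -> i = j.
Proof.
rewrite /disk /= => ni nj xi xj; apply/eqP/negPn/negP => ij.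
have := sep ni nj ij; have := dist2_triangle x (c i) (c j).
move: xi xj r0; rewrite (dist2C _ x); lra.
Qed.

Lemma area_disks_ge : ((n%:R * r ^+ 2)%:E <= area E)%E.
Proof.
rewrite areaE /E measure_fin_bigcup //=; last by move=> i _; exact: measurable_disk.
  rewrite -fsbig_ord /=.
  have -> : n%:R * r ^+ 2 = \sum_(i < n) r ^+ 2 by rewrite sumr_const card_ord mulr_natl.
  rewrite -sumEFin; apply: lee_sum => i _; exact: area_disk_ge.
by move=> i j /= ni nj [x [xi xj]]; exact: (disks_trivIset ni nj xi xj).
Qed.

(** At [p] on circle [i], take the outer unit normal [(p - c i) / r]. With normal and tangential
    coordinates [u] and [s], the disk is [s^2 + (u + r)^2 < r^2], that is,
    [u < sqrt (r^2 - s^2) - r] as long as [u + r >= 0]. *)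
Lemma smooth_boundary_disks : smooth_boundary E.
Proof.
move=> p /boundary_disks[i ni pr].
have [n1 [n2 [p1 p2]]] : exists n1 n2, p.1 = (c i).1 + r * n1 /\ p.2 = (c i).2 + r * n2.
  exists ((p.1 - (c i).1) / r), ((p.2 - (c i).2) / r).
  by split; field; rewrite gt_eqF.
have nn : n1 * n1 + n2 * n2 = 1.
  have := sqr_dist2 p (c i); rewrite pr p1 p2 => h.
  apply: (mulfI (x := r ^+ 2)); first by rewrite expf_neq0 // gt_eqF.
  by rewrite mulr1 [RHS]h; ring.
exists (n1, n2), r, (fun t => Num.sqrt (r ^+ 2 - t ^+ 2) - r); split => //.
  exact: smooth_arc.
move=> x; rewrite /disk /= => xp.
(* If [x] were in another disk [j], the path from [c i] through [p] and [x] to [c j] would be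
   shorter than [3 r]. *)
have -> : E x <-> dist2 x (c i) < r.
  split => [[j /= nj xj]|xi]; last by exists i.
  have [-> //|ij] := eqVneq i j.
  have := sep ni nj ij; have := dist2_triangle x (c i) (c j).
  have := dist2_triangle p (c i) x; rewrite (dist2C (c i) p) (dist2C p x).
  move: xp xj r0; rewrite /disk /= pr; lra.
rewrite dist2_lt // in xp; rewrite dist2_lt //.
rewrite /dot2 /=; move: xp p1 p2; set x1 := x.1 - p.1; set x2 := x.2 - p.2.
move=> xp p1 p2.
set u := x1 * n1 + x2 * n2; set s := x1 * - n2 + x2 * n1.
have us : u ^+ 2 + s ^+ 2 = x1 ^+ 2 + x2 ^+ 2.
  rewrite -[RHS]mulr1 -nn /u /s; ring.
have -> : (x.1 - (c i).1) ^+ 2 + (x.2 - (c i).2) ^+ 2 = s ^+ 2 + (u + r) ^+ 2.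
  have -> : x.1 - (c i).1 = x1 + r * n1 by rewrite /x1 p1; ring.
  have -> : x.2 - (c i).2 = x2 + r * n2 by rewrite /x2 p2; ring.
  have -> : s ^+ 2 + (u + r) ^+ 2 = u ^+ 2 + s ^+ 2 + 2 * u * r + r ^+ 2 * (n1 * n1 + n2 * n2).
    by rewrite nn; ring.
  by rewrite us /u; ring.
have u2 : u ^+ 2 < r ^+ 2 by rewrite (le_lt_trans _ xp) // -us lerDl sqr_ge0.
have /andP[ur _] : - r < u < r.
  by rewrite -ltr_norml -(@ltr_pXn2r _ 2) ?nnegrE ?(ltW r0) // real_normK ?num_real.
have ur0 : 0 <= u + r by rewrite -lerBlDr sub0r ltW.
rewrite ltrBrDr -[u + r < _](@ltr_pXn2r _ 2) ?nnegrE ?sqrtr_ge0 //.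
rewrite sqr_sqrtr; last first.
  by rewrite subr_ge0 ltW // (le_lt_trans _ xp) // -us lerDr sqr_ge0.
by rewrite ltrBrDl.
Qed.
End union_of_disks.

(** * Disks inside an unbounded convex set and the resulting Cheeger bound *)

Section cheeger.
Context {R : realType}.
Implicit Types (Omega : set (R * R)) (p x y : R * R).

Lemma cheeger_ge0 (q : R) Omega : (0 <= cheeger q Omega)%E.
Proof.
apply: le_ereal_inf_tmp => _ [E [_ _ _ _ ->]].
by rewrite mule_ge0 ?hausdorff1_ge0 // inve_ge0 poweR_ge0.
Qed.

Lemma open_disk_sub Omega p : open Omega -> Omega p ->
  exists2 rho, 0 < rho & disk p rho `<=` Omega.
Proof.
move=> oO Op; have /nbhs_ballP[e /= e0 eO] := open_nbhs_nbhs (conj oO Op).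
exists e => // x xe; apply: eO; rewrite -ball_normE /= distrC.
exact: le_lt_trans (norm_le_dist2 x p) xe.
Qed.

(** [bounded_set] refers to the max norm, which [dist2] dominates. *)
Lemma unbounded_far Omega p (M : R) : ~ bounded_set Omega ->
  exists2 x, Omega x & M < dist2 x p.
Proof.
move=> ubO; apply: contrapT => nfar; apply: ubO.
exists (M + `|p|); split; first exact: num_real.
move=> y My x Ox; rewrite /= (le_trans _ (ltW My)) // -lerBlDr.
rewrite (le_trans (lerB_dist _ _)) // (le_trans (norm_le_dist2 _ _)) // leNgt.
by apply/negP => Mx; apply: nfar; exists x.
Qed.

Definition along p x (s : R) : R * R := p + s *: (x - p).

(** The homothety of center [x] and ratio [1 - s >= 1/2] sends [disk p rho] to a disk about
    [along p x s] of radius at least [rho / 2], and convexity keeps it in [Omega]. *)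
Lemma convex_disk_along Omega p x (rho s : R) : convex_set Omega ->
  disk p rho `<=` Omega -> 0 < rho -> Omega x -> 0 <= s <= 2^-1 ->
  disk (along p x s) (rho / 2) `<=` Omega.
Proof.
move=> cO pO rho0 Ox /andP[s0 s1] y; rewrite /disk /= dist2_lt ?divr_gt0 //= => ys.
have s2 : 0 < 1 - s by lra.
(* The preimage of [y] under the homothety: [y = s x + (1 - s) z]. *)
pose z : R * R := ((y.1 - s * x.1) / (1 - s), (y.2 - s * x.2) / (1 - s)).
have Oz : Omega z.
  apply: pO; rewrite /disk /= dist2_lt //=.
  have -> : (y.1 - s * x.1) / (1 - s) - p.1 = (y.1 - (p.1 + s * (x.1 - p.1))) / (1 - s).
    by field; rewrite gt_eqF.
  have -> : (y.2 - s * x.2) / (1 - s) - p.2 = (y.2 - (p.2 + s * (x.2 - p.2))) / (1 - s).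
    by field; rewrite gt_eqF.
  rewrite !expr_div_n -mulrDl ltr_pdivrMr ?exprn_gt0 //.
  apply: (lt_le_trans ys); rewrite expr_div_n -exprVn ler_pM2l ?exprn_gt0 //.
  by rewrite ler_pXn2r ?nnegrE ?(ltW s2) //; lra.
have := cO x z (Itv01 s0 (ltac:(lra) : s <= 1)).
rewrite !inE => /(_ Ox Oz); congr Omega.
rewrite [RHS]surjective_pairing; congr (_, _) => /=.
  rewrite /GRing.scale /= /unstable.onem; field; by rewrite gt_eqF.
rewrite /GRing.scale /= /unstable.onem; field; by rewrite gt_eqF.
Qed.

Lemma dist2_along p x (s t : R) :
  dist2 (along p x s) (along p x t) = `|s - t| * dist2 x p.
Proof.
rewrite !dist2E /along /=.
have -> : forall a b : R, a + s *: b - (a + t *: b) = (s - t) * b.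
  by move=> a b; rewrite /GRing.scale /=; ring.
have -> : forall a b : R, a + s *: b - (a + t *: b) = (s - t) * b.
  by move=> a b; rewrite /GRing.scale /=; ring.
by rewrite !exprMn -mulrDr sqrtrM ?sqr_ge0 // sqrtr_sqr.
Qed.

Lemma cheeger_le_disks (q : R) Omega p (rho : R) (n : nat) : (0 < n)%N ->
  0 < q -> convex_set Omega -> ~ bounded_set Omega ->
  0 < rho -> disk p rho `<=` Omega ->
  (cheeger q Omega <=
    (n%:R * (8 * (rho / 4)) / (n%:R * (rho / 4) ^+ 2) `^ q^-1)%:E)%E.
Proof.
move=> n0 q0 cO ubO rho0 pO.
have n0' : 0 < n%:R :> R by rewrite ltr0n.
have r0 : 0 < rho / 4 by rewrite divr_gt0.
(* The [n] centers lie at steps of [1 / (2 n)] in the first half of the segment from [p] to [x], so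
   this length keeps them at least [rho = 4 (rho / 4)] apart. *)
have [x Ox xfar] := unbounded_far p (2 * n%:R * rho) ubO.
pose c i := along p x (i%:R / (2 * n%:R)).
have sep i j : (i < n)%N -> (j < n)%N -> i != j -> 4 * (rho / 4) <= dist2 (c i) (c j).
  move=> _ _ ij; rewrite /c dist2_along -mulrBl normrM.
  rewrite (ger0_norm (x := _^-1)) ?invr_ge0 ?mulr_ge0 // -mulrA.
  have -> : 4 * (rho / 4) = 1 * rho by field.
  apply: ler_pM; rewrite ?(ltW rho0) //.
    rewrite ler_normr lerBrDr opprB lerBrDr ![1 + _]addrC !natr1 !ler_nat; lia.
  by rewrite ler_pdivlMl ?mulr_gt0 // ltW.
set E := \bigcup_(i in `I_n) disk (c i) (rho / 4).
have EO : closure E `<=` Omega.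
  move=> y /closure_disks[i /= ni yi].
  apply: (convex_disk_along cO pO rho0 Ox (s := i%:R / (2 * n%:R))).
    rewrite divr_ge0 ?mulr_ge0 //= ler_pdivrMr ?mulr_gt0 // mulKf //.
    by rewrite ler_nat ltnW.
  rewrite /disk /= (le_lt_trans yi) //; lra.
have Ene : E !=set0.
  exists (c 0%N), 0%N => //; rewrite /disk /= dist2_lt // !subrr expr0n addr0.
  by rewrite exprn_gt0.
apply: (@le_trans _ _ (hausdorff1 (boundary E) / (area E `^ q^-1))%E).
  apply: ereal_inf_lbound; exists E; split => //.
  - exact: open_disks.
  - exact: smooth_boundary_disks.
  - by split => //; exact: compact_closure_disks.
rewrite EFinM; apply: lee_pmul.
- exact: hausdorff1_ge0.
- by rewrite inve_ge0 poweR_ge0.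
- exact: hausdorff1_boundary_disks.
(* Positivity makes the extended-real inverse agree with the real one. *)
have m0 : 0 < n%:R * (rho / 4) ^+ 2 by rewrite mulr_gt0 // exprn_gt0.
have -> : (((n%:R * (rho / 4) ^+ 2) `^ q^-1)^-1%:E =
    ((n%:R * (rho / 4) ^+ 2)%:E `^ q^-1)^-1)%E.
  by rewrite poweR_EFin inver gt_eqF // powR_gt0.
have mA := area_disks_ge r0 sep.
rewrite lee_pV2 ?inE ?poweR_ge0 //; apply: gt0_ler_poweR (mA).
- by rewrite invr_ge0 ltW.
- by rewrite in_itv /= lee_fin (ltW m0) leey.
- by rewrite in_itv /= leey (le_trans _ mA) // lee_fin ltW.
Qed.
End cheeger.

Theorem lemma5p6 (R : realType) (Omega : set (R * R)) (q : R) :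
  open Omega -> convex_set Omega -> ~ bounded_set Omega ->
  (inradius Omega < +oo)%E ->
  0 < q -> q < 1 ->
  cheeger q Omega = 0%E.
Proof.
move=> oO cO ubO _ q0 q1; apply/eqP; rewrite eq_le cheeger_ge0 andbT.
(* Unboundedness is used here only to get a point of [Omega]. *)
have [p Op _] := unbounded_far 0 0 ubO.
have [rho rho0 pO] := open_disk_sub oO Op.
apply/lee_addgt0Pr => e e0; rewrite add0e.
have r0 : 0 < rho / 4 by rewrite divr_gt0.
set r := rho / 4 in r0.
have a1 : 0 < q^-1 - 1 by rewrite subr_gt0 invf_gt1.
(* The bound for [n] disks equals [K / n^(1/q - 1)], with positive exponent since [q < 1]. *)
pose K := 8 * r / (r ^+ 2) `^ q^-1.
have rq0 : 0 < (r ^+ 2) `^ q^-1 by rewrite powR_gt0 // exprn_gt0.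
have K0 : 0 < K by rewrite divr_gt0 ?mulr_gt0.
(* Solves [m^(1/q - 1) = K / e]; any integer [n >= m] then brings the bound below [e]. *)
pose m := (K / e) `^ (q^-1 - 1)^-1.
pose n := (Num.truncn m).+1.
have n0 : 0 < n%:R :> R by rewrite ltr0n.
apply: (le_trans (cheeger_le_disks (n := n) _ q0 cO ubO rho0 pO)) => //.
rewrite lee_fin -/r powRM ?(ltW n0) ?sqr_ge0 //.
have -> : n%:R `^ q^-1 = n%:R * n%:R `^ (q^-1 - 1) :> R.
  rewrite -[X in X * _]powRr1 ?(ltW n0) // -powRD ?(gt_eqF n0) ?implybT //.
  by congr (_ `^ _); ring.
have p0 : 0 < n%:R `^ (q^-1 - 1) :> R by rewrite powR_gt0.
have -> : n%:R * (8 * r) / (n%:R * n%:R `^ (q^-1 - 1) * (r ^+ 2) `^ q^-1)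
   = K / n%:R `^ (q^-1 - 1).
  by rewrite /K; field; rewrite !gt_eqF.
rewrite ler_pdivrMr // mulrC -ler_pdivrMr //.
have -> : K / e = m `^ (q^-1 - 1).
  by rewrite /m -powRrM mulVf ?gt_eqF // powRr1 // divr_ge0 // ltW.
apply: ge0_ler_powR; rewrite ?nnegrE ?powR_ge0 ?(ltW a1) ?(ltW n0) //.
exact/ltW/truncnS_gt.
Qed.
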